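(* Every non-trivial graph $G$ has a $T$-partition of width at most $18(\operatorname{tw}(G)+1)\Delta(G)$ for some tree $T$ with $\Delta(T)\leq 6\Delta(G)$.
   Context: All graphs are finite and simple. A graph $G$ is non-trivial if $E(G)\neq\emptyset$. $\Delta(G)$ denotes the maximum degree of $G$, and $\operatorname{tw}(G)$ its treewidth. For a graph $G$ and a tree $T$, a $T$-partition of $G$ is a family $(V_x : x\in V(T))$ of pairwise disjoint subsets of $V(G)$ (some possibly empty) with union $V(G)$, indexed by the nodes of $T$, such that for every edge $vw$ of $G$, if $v\in V_x$ and $w\in V_y$ then $x=y$ or $xy\in E(T)$. A tree-partition of $G$ is a $T$-partition for some tree $T$. The width of a $T$-partition is $\max\{|V_x| : x\in V(T)\}$. *)

(* Defs.v *)
From Stdlib Require Import ClassicalEpsilon.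
From mathcomp Require Import all_boot.
Set Implicit Arguments. Unset Strict Implicit. Unset Printing Implicit Defensive.

Definition simple_graph (V : finType) (e : rel V) : Prop :=
  symmetric e /\ irreflexive e.

Definition nontrivial (V : finType) (e : rel V) : Prop :=
  exists u v, e u v.

Definition maxdeg (V : finType) (e : rel V) : nat :=
  \max_(v : V) #|[set u | e v u]|.

Definition acyclic (W : finType) (t : rel W) : Prop :=
  forall c : seq W, uniq c -> 3 <= size c -> ~~ cycle t c.

Definition is_tree (n : nat) (t : rel 'I_n) : Prop :=
  [/\ simple_graph t, 0 < n, (forall x y, connect t x y) & acyclic t].

Definition tree_decomposition (V : finType) (e : rel V)
    (n : nat) (t : rel 'I_n) (B : 'I_n -> {set V}) : Prop :=
  [/\ is_tree t,
      (forall v, exists x, v \in B x),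
      (forall u v, e u v -> exists x, (u \in B x) && (v \in B x)) &
      (forall v, let S := [set x | v \in B x] in
         forall x y, x \in S -> y \in S ->
           connect [rel a b | [&& t a b, a \in S & b \in S]] x y)].

Definition has_td_width (V : finType) (e : rel V) (k : nat) : Prop :=
  exists n (t : rel 'I_n) (B : 'I_n -> {set V}),
    tree_decomposition e t B /\ forall x, #|B x| <= k.+1.

Definition has_td_widthb (V : finType) (e : rel V) (k : nat) : bool :=
  if excluded_middle_informative (has_td_width e k) then true else false.

Lemma has_td_width_exists (V : finType) (e : rel V) :
  exists k, has_td_widthb e k.
Proof.
exists #|V|; rewrite /has_td_widthb.
case: excluded_middle_informative => // [[]].
exists 1, (fun _ _ => false), (fun _ => setT); split; last first.
  by move=> x; rewrite cardsT leqW.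
split.
- split => //.
  + by move=> x y; rewrite (ord1 x) (ord1 y) connect0.
  + by move=> [|a [|b [|c s]]].
- by move=> v; exists ord0; rewrite inE.
- by move=> u v _; exists ord0; rewrite !inE.
- move=> v S x y _ _; rewrite (ord1 x) (ord1 y); exact: connect0.
Qed.

Definition treewidth (V : finType) (e : rel V) : nat :=
  ex_minn (has_td_width_exists e).

Definition T_partition (V : finType) (e : rel V)
    (n : nat) (t : rel 'I_n) (P : 'I_n -> {set V}) : Prop :=
  [/\ (forall x y, x != y -> [disjoint P x & P y]),
      \bigcup_(x < n) P x = [set: V] &
      (forall v w x y, e v w -> v \in P x -> w \in P y -> x = y \/ t x y)].

Definition partition_width (V : finType) (n : nat) (P : 'I_n -> {set V}) : nat :=
  \max_(x < n) #|P x|.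

(* Main.v *)
Require Import Defs.
From mathcomp Require Import all_boot zify.
Set Implicit Arguments. Unset Strict Implicit. Unset Printing Implicit Defensive.

(* Let [k] be the treewidth plus one and [d] the maximum degree.  By induction on
   the vertex set [U], any [S] in [U] with [4k <= |S| <= 12kd] lies in the root bag
   of a tree-partition of [U] in which the root has size at most [3|S|/2 - 2k] and
   at most [|S|/(2k) - 1] children.  If [|U \ S| <= 4k], two bags suffice.
   If [|S| <= 12k], put [S] alone in a new root above a partition of [U \ S] whose
   root contains the neighbours of [S].  Otherwise a bag of a tree-decomposition
   separates [U] into two sides, each missing at most [2|S|/3] of [S]; partition
   both sides with the separator added to [S] and identify the two roots.  The
   slack terms [2k] and [1] are what pays for the separator being counted twice. *)

(** * Finite sets: cardinalities and balanced splitting *)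

Lemma card_bigcup_le (I T : finType) (S : {set I}) (F : I -> {set T}) (d : nat) :
  (forall i, i \in S -> #|F i| <= d) -> #|\bigcup_(i in S) F i| <= d * #|S|.
Proof.
move=> Fd; apply: (@leq_trans (\sum_(i in S) #|F i|)).
  elim/big_rec2: _ => [|i m A _ le_Am]; first by rewrite cards0.
  by rewrite (leq_trans (leq_card_setU _ _)) // leq_add2l.
by rewrite mulnC -sum_nat_const leq_sum.
Qed.

Lemma subset_of_card_between (T : finType) (A B : {set T}) (m : nat) :
  A \subset B -> #|A| <= m <= #|B| ->
  exists C : {set T}, [/\ A \subset C, C \subset B & #|C| = m].
Proof.
move=> AB /andP[Am mB]; move: Am; have [r] := ubnP (m - #|A|).
elim: r => // r IHr in A AB * => lt_r Am.
have [eqAm|neqAm] := eqVneq #|A| m; first by exists A.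
have /properP[_ [x xB xA]] : A \proper B.
  by rewrite properEcard AB /=; lia.
have cardxA : #|x |: A| = #|A|.+1 by rewrite cardsU1 xA.
have [||| C [AC CB cC]] := IHr (x |: A); rewrite ?cardxA; try lia.
  by rewrite subUset sub1set xB.
by exists C; split=> //; apply: subset_trans AC; apply: subsetUr.
Qed.

(** A single weight of at least [s / 3] can form [Y] by itself. Otherwise take [Y] of maximal size
    with weight at most [2s / 3]: one more element, of weight below [s / 3], exceeds that bound, so
    [Y] already weighs more than [s / 3]. *)
Lemma balanced_bipartition (I : finType) (w : I -> nat) (s : nat) :
  \sum_i w i <= s -> (forall i, 2 * w i <= s) ->
  exists Y : {set I}, 3 * \sum_(i in Y) w i <= 2 * s /\
                      3 * \sum_(i in ~: Y) w i <= 2 * s.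
Proof.
move=> sum_le half.
have split_sum (Y : {set I}) :
    \sum_i w i = \sum_(i in Y) w i + \sum_(i in ~: Y) w i.
  rewrite (bigID (mem Y)) /=; congr (_ + _).
  by apply: eq_bigl => i; rewrite inE.
have [/existsP[i wi]|/existsPn small] := boolP [exists i, s <= 3 * w i].
  exists [set i]; have := split_sum [set i]; have := half i.
  by rewrite big_set1; lia.
pose ok (Y : {set I}) := 3 * \sum_(i in Y) w i <= 2 * s.
have ok0 : ok set0 by rewrite /ok big_set0.
case: (arg_maxnP (fun Y : {set I} => #|Y|) ok0) => Y okY maxY.
exists Y; split=> //.
have [->|[i]] := set_0Vmem (~: Y); first by rewrite big_set0.
rewrite inE => iY.
have : ~~ ok (i |: Y).
  by apply/negP => /maxY; rewrite cardsU1 iY /= ltnn.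
rewrite /ok big_setU1 //=.
by have := split_sum Y; have := small i; lia.
Qed.

(** * Paths and cycles in forests *)

(** A duplicate-free path from [x] to [y] that avoids the edge [xy] has at least three vertices, so
    this edge would close it to a cycle. *)
Lemma acyclic_edge_bridge (W : finType) (t : rel W) (x y : W) :
  symmetric t -> acyclic t -> x != y -> t x y ->
  ~~ connect [rel a b | t a b && ([set a; b] != [set x; y])] x y.
Proof.
move=> tsym tacyc xy txy; apply/negP => /connectP[p0 pth ylast].
case/shortenP: pth ylast => p pth unq _ ylast.
case: p => [|a [|b p]] in pth unq ylast *.
- by rewrite /= in ylast; rewrite ylast eqxx in xy.
- by rewrite /= in ylast; rewrite /= ylast eqxx andbF in pth.
have /negP := tacyc _ unq isT; apply.
rewrite [cycle _ _]/= -/(path t a (rcons (b :: p) x)).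
have -> : t x a && path t a (rcons (b :: p) x) = path t x (rcons [:: a, b & p] x) by [].
rewrite rcons_path -ylast tsym txy andbT.
by apply: sub_path pth => u v /= /andP[].
Qed.

(* The eventual cycle of the iterates of [f] is a cycle of [t], so it has length 2. *)
Lemma acyclic_self_map_backtracks (W : finType) (t : rel W) (f : W -> W) (x0 : W) :
  irreflexive t -> acyclic t -> (forall x, t x (f x)) -> exists x, f (f x) = x.
Proof.
move=> tirr tacyc tf.
have /loopingP/(_ (order f x0))/trajectP[i lt_i loop] := looping_order f x0.
set x := iter i f x0 in loop; exists x.
have periodic : exists m, iter m.+1 f x = x.
  exists (order f x0 - i).-1; rewrite prednK ?subn_gt0 // /x -iterD.
  by rewrite subnK // ltnW.
have fcyc : fcycle f (orbit f x) by apply/(orbitPcycle 0 3).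
have iter_order : iter (order f x) f x = x by apply/(orbitPcycle 0 4).
have /(_ (orbit_uniq f x)) := tacyc (orbit f x).
have -> : cycle t (orbit f x).
  by apply: (sub_cycle _ fcyc) => a b /= /eqP<-.
rewrite size_orbit leqNgt; case: (order f x) (order_gt0 f x) iter_order => //.
case=> [_ /= fx|[_ //|m _ _ /(_ isT) //]].
by have := tf x; rewrite fx tirr.
Qed.

(** * Balanced separations from a tree-decomposition *)

Section Separator.

Variables (V : finType) (e : rel V) (n : nat) (t : rel 'I_n) (B : 'I_n -> {set V}).
Hypothesis td : tree_decomposition e t B.

Definition avoid (x : 'I_n) := [rel a b | [&& t a b, a != x & b != x]].

Lemma td_sym : symmetric t. Proof. by case: td => [[[]]]. Qed.
Lemma td_irr : irreflexive t. Proof. by case: td => [[[]]]. Qed.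
Lemma td_acyclic : acyclic t. Proof. by case: td => [[]]. Qed.

Lemma avoid_sym x : connect_sym (avoid x).
Proof.
apply: sym_connect_sym => a b /=.
by rewrite td_sym [(a != x) && _]andbC.
Qed.

Lemma avoid_neq x a b : connect (avoid x) a b -> a != x -> b != x.
Proof.
case/connectP => p pth -> ax.
elim: p a ax pth => //= c p IH a ax /andP[/and3P[_ _ cx]]; exact: IH.
Qed.

(** A duplicate-free path from [x] to [c] never returns to [x], so after its first step it avoids
    [x]. *)
Lemma neighbor_towards x c : c != x -> exists2 y, t x y & connect (avoid x) y c.
Proof.
have [[_ _ conn _] _ _ _] := td; move=> cx.
case/connectP: (conn x c) => p0 pth clast.
case/shortenP: pth clast => [[|y p]] pth unq _ clast.
  by rewrite clast eqxx in cx.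
move: pth unq => /= /andP[txy pth] /andP[xyp _].
exists y => //; apply/connectP; exists p; last exact: clast.
elim: p y {txy clast} xyp pth => //= b p IH a; rewrite !inE !negb_or.
move=> /and3P[xa xb xp] /andP[-> pth].
by rewrite eq_sym xa eq_sym xb /=; apply: IH => //; rewrite inE negb_or xb.
Qed.

(** A choice among the nodes holding [v], with node 0 as the default. *)
Definition node v : 'I_n := odflt (Ordinal (let: And4 (And4 _ h _ _) _ _ _ := td in h))
                       [pick x | v \in B x].

Lemma nodeP v : v \in B (node v).
Proof.
rewrite /node; case: pickP => //= none.
by have [_ /(_ v) [x]] := td; rewrite none.
Qed.

(** Names a component of the tree minus [x] by its canonical representative. For [v] outside [B x],
    every node holding [v] gives the same component, by [part_avoids]. *)
Definition part x v := root (avoid x) (node v).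

(** The nodes holding [v] induce a connected subtree that misses [x]. *)
Lemma part_avoids x y v : v \notin B x -> v \in B y -> connect (avoid x) (node v) y.
Proof.
have [_ _ _ /(_ v)/= sub] := td => vx vy.
have := sub (node v) y; rewrite !inE => /(_ (nodeP v) vy).
apply: connect_sub => a b /= /and3P[tab]; rewrite !inE => va vb.
apply: connect1; rewrite /= tab /=.
by apply/andP; split; apply: contraNneq vx => <-.
Qed.

Lemma part_edge x u v : u \notin B x -> v \notin B x -> e u v -> part x u = part x v.
Proof.
have [_ _ cov _] := td => ux vx /cov[y /andP[uy vy]].
apply/(rootP (@avoid_sym x)); apply: connect_trans (part_avoids ux uy) _.
by rewrite avoid_sym part_avoids.
Qed.

(* If every node had a heavy component, stepping towards it would backtrack along
   some edge, and the two heavy components would then be disjoint. *)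
Lemma balanced_bag (S : {set V}) :
  exists x, forall c, 2 * #|[set v in S | v \notin B x & part x v == c]| <= #|S|.
Proof.
pose wt x c := [set v in S | v \notin B x & part x v == c].
have [/existsP[x /forallP bal]|/existsPn heavy] :=
    boolP [exists x, forall c, 2 * #|wt x c| <= #|S|].
  by exists x.
have step x : exists y, t x y /\ exists2 c, connect (avoid x) y c & #|S| < 2 * #|wt x c|.
  have /forallPn[c] := heavy x; rewrite -ltnNge => hc.
  have /card_gt0P[v] : 0 < #|wt x c| by lia.
  rewrite inE => /and3P[vS vx /eqP pv].
  have [|y txy yc] := @neighbor_towards x c.
    apply: (@avoid_neq x (node v)); first by rewrite -pv connect_root.
    by apply: contraNneq vx => <-; apply: nodeP.
  by exists y; split=> //; exists c.
pose f x := odflt x [pick y | t x y && [exists c, connect (avoid x) y c && (#|S| < 2 * #|wt x c|)]].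
have fP x : t x (f x) && [exists c, connect (avoid x) (f x) c && (#|S| < 2 * #|wt x c|)].
  rewrite /f; case: pickP => //= none; have [y [txy [c yc hc]]] := step x.
  by have /negP[] := negbT (none y); rewrite txy; apply/existsP; exists c; rewrite yc.
have x0 : 'I_n by case: td => [[_ n0 _ _] _ _ _]; exact: Ordinal n0.
have [|x ffx] := acyclic_self_map_backtracks x0 td_irr td_acyclic (f := f).
  by move=> x; case/andP: (fP x).
set y := f x in ffx.
have /andP[txy /existsP[c /andP[yc hc]]] := fP x.
have /andP[_ /existsP[c' /andP[xc' hc']]] := fP y; rewrite ffx in xc'.
rewrite -/y in txy yc.
have xy : x != y by apply: contraTneq txy => <-; rewrite td_irr.
(* Each of the two sets contains more than half of [S], so they meet. *)
have [v] : exists v, v \in wt x c :&: wt y c'.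
  apply/card_gt0P; have := cardsUI (wt x c) (wt y c').
  have : #|wt x c :|: wt y c'| <= #|S|.
    by apply: subset_leq_card; apply/subsetP => v; rewrite !inE => /orP[]/and3P[].
  by lia.
rewrite !inE => /andP[/and3P[vS vx /eqP pvc] /and3P[_ vy /eqP pvc']].
have yv : connect (avoid x) y (node v).
  by apply: connect_trans yc _; rewrite avoid_sym -pvc connect_root.
have xv : connect (avoid y) x (node v).
  by apply: connect_trans xc' _; rewrite avoid_sym -pvc' connect_root.
(* The node of [v] is reached from [y] without [x] and from [x] without [y]; together the two walks
   join [x] to [y] without the edge [xy]. *)
have /negP[] := acyclic_edge_bridge td_sym td_acyclic xy txy.
set r := (r in connect r).
have rsym : connect_sym r.
  by apply: sym_connect_sym => a b; rewrite /r /= td_sym setUC.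
have avoid_r z a b : z \in [set x; y] -> connect (avoid z) a b -> connect r a b.
  move=> zxy; apply: connect_sub => {}a {}b /= /and3P[tab az bz].
  apply: connect1; rewrite /r /= tab /=; apply/eqP => eqab.
  by move: zxy; rewrite -eqab !inE ![z == _]eq_sym (negbTE az) (negbTE bz).
apply: (connect_trans (avoid_r y _ _ _ xv)); first by rewrite !inE eqxx orbT.
by rewrite rsym; apply: avoid_r yv; rewrite !inE eqxx.
Qed.

(** The components left by a balanced bag, weighted by their share of [S], are split into two
    classes; each side is the bag plus one class, so the sides meet in the bag alone. *)
Lemma balanced_separation (k : nat) (S : {set V}) :
  (forall x, #|B x| <= k) ->
  exists A1 A2 : {set V},
    [/\ A1 :|: A2 = setT, #|A1 :&: A2| <= k,
        (forall u v, e u v -> (u \in A1) && (v \in A1) || (u \in A2) && (v \in A2)),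
        3 * #|S :\: A1| <= 2 * #|S| & 3 * #|S :\: A2| <= 2 * #|S|].
Proof.
move=> Bk; have [x bal] := balanced_bag S.
have count (Y : {set 'I_n}) :
    #|[set v in S | v \notin B x & part x v \in Y]| =
    \sum_(c in Y) #|[set v in S | v \notin B x & part x v == c]|.
  rewrite -sum1_card (partition_big (part x) (mem Y)) /=; last first.
    by move=> v; rewrite inE => /and3P[].
  apply: eq_bigr => c cY; rewrite -sum1_card; apply: eq_bigl => v.
  rewrite !inE -!andbA; case: eqP => [->|_]; last by rewrite !andbF.
  by rewrite cY.
have [|Y [Y1 Y2]] := balanced_bipartition _ bal.
  have -> : \sum_(c < n) #|[set v in S | v \notin B x & part x v == c]| =
            \sum_(c in [set: 'I_n]) #|[set v in S | v \notin B x & part x v == c]|.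
    by apply: eq_bigl => c; rewrite inE.
  rewrite -count; apply: subset_leq_card.
  by apply/subsetP => v; rewrite inE => /andP[].
rewrite -!count in Y1 Y2.
exists [set v | (v \in B x) || (part x v \in Y)].
exists [set v | (v \in B x) || (part x v \notin Y)]; split.
- by apply/setP => v; rewrite !inE; case: (v \in B x); case: (_ \in Y).
- apply: leq_trans (Bk x); apply: subset_leq_card; apply/subsetP => v.
  by rewrite !inE; case: (v \in B x); case: (_ \in Y).
- move=> u v euv; rewrite !inE.
  have [ux|ux] := boolP (u \in B x); have [vx|vx] := boolP (v \in B x) => //=.
  + by case: (_ \in Y).
  + by case: (_ \in Y).
  + by rewrite (part_edge ux vx euv); case: (_ \in Y).
- apply: leq_trans Y2; rewrite leq_mul2l /=; apply: subset_leq_card.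
  by apply/subsetP => v; rewrite !inE negb_or => /andP[/andP[-> ->] ->].
- apply: leq_trans Y1; rewrite leq_mul2l /=; apply: subset_leq_card.
  by apply/subsetP => v; rewrite !inE negb_or negbK => /andP[/andP[-> ->] ->].
Qed.

End Separator.

(** * Rooted trees as parent sequences *)

(* A rooted tree is encoded by its sequence of parents: the nodes are
   0, ..., size q, the root is 0, and the parent of j.+1 is nth 0 q j. *)
Definition parent_seq (q : seq nat) : Prop := forall j, nth 0 q j <= j.

(** Here [a] is the child and [b] the parent; the bounds on [a] exclude the root and the default
    value of [nth]. *)
Definition child (q : seq nat) (a b : nat) : bool :=
  [&& 0 < a, a <= size q & nth 0 q a.-1 == b].

Definition tree_adj (q : seq nat) (a b : nat) : bool := child q a b || child q b a.

Definition parent_tree (q : seq nat) (a b : 'I_(size q).+1) : bool := tree_adj q a b.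
Arguments parent_tree : clear implicits.
Arguments child q a b /.
Arguments tree_adj q a b /.
Arguments parent_tree q a b /.

Lemma child_lt q a b : parent_seq q -> child q a b -> b < a.
Proof. by move=> wf /and3P[a0 _ /eqP<-]; have := wf a.-1; lia. Qed.

Lemma parent_tree_is_tree q : parent_seq q -> is_tree (parent_tree q).
Proof.
move=> wf.
have tsym : symmetric (parent_tree q) by move=> a b; exact: orbC.
have tirr : irreflexive (parent_tree q).
  by move=> a; apply/negP; rewrite /parent_tree /tree_adj orbb => /(child_lt wf); rewrite ltnn.
split=> //.
(* Parents are smaller than their children, so climbing from any node ends at 0. *)
- have conn0 : forall m (x : 'I_(size q).+1), x < m -> connect (parent_tree q) x ord0.
    elim=> // m IH x xm.
    have [x0|x0] := posnP x.
      by have -> : x = ord0 by [apply: val_inj]; apply: connect0.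
    have ltp : nth 0 q x.-1 < x by have := wf x.-1; lia.
    have ltp' : nth 0 q x.-1 < (size q).+1 by apply: ltn_trans ltp _.
    apply: (@connect_trans _ _ (Ordinal ltp')); last by apply: IH => /=; lia.
    by apply: connect1; rewrite /= x0 eqxx -ltnS ltn_ord.
  move=> x y; apply: connect_trans (conn0 _ x (ltnSn _)) _.
  by rewrite (sym_connect_sym tsym); apply: conn0 (ltnSn _).
- (* The two cycle-neighbours of the largest node would both be its parent. *)
  move=> [|c0 c1] // unq sz; apply/negP => cyc.
  have [m mc maxm] := arg_maxnP (fun x : 'I_(size q).+1 => val x) (mem_head c0 c1).
  have [i s rot_c] := rot_to mc.
  have {}cyc : cycle (parent_tree q) (m :: s) by rewrite -rot_c rot_cycle.
  have {}unq : uniq (m :: s) by rewrite -rot_c rot_uniq.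
  have {}sz : 2 < size (m :: s) by rewrite -rot_c size_rot.
  have {}maxm : forall x, x \in m :: s -> x <= m.
    by move=> x; rewrite -rot_c mem_rot; apply: maxm.
  have to_parent x : x \in m :: s -> parent_tree q m x -> val x = nth 0 q m.-1.
    move=> /maxm xm /orP[/and3P[_ _ /eqP] //|/(child_lt wf)].
    by rewrite ltnNge xm.
  case: s unq sz maxm to_parent cyc {rot_c} => [|a [|b s]] // unq _ _ to_parent cyc.
  move: cyc; rewrite /cycle rcons_path => /andP[/= /andP[tma _] tlm].
  have ea : val a = nth 0 q m.-1.
    by apply: to_parent tma; rewrite !inE eqxx orbT.
  have eb : val (last b s) = nth 0 q m.-1.
    apply: to_parent; last by rewrite tsym.
    by rewrite !inE -in_cons mem_last !orbT.
  have eab : a = last b s by apply: val_inj; rewrite ea eb.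
  by move: unq => /= /and3P[_ /negP[]]; rewrite eab mem_last.
Qed.

Lemma parent_tree_degree q (x : 'I_(size q).+1) : parent_seq q ->
  #|[set y | parent_tree q x y]| <= count_mem (val x) q + (0 < x).
Proof.
move=> wf.
have sub : [set y | parent_tree q x y] \subset
    [set y : 'I_(size q).+1 | child q y x] :|: [set y : 'I_(size q).+1 | child q x y].
  by apply/subsetP => y; rewrite !inE orbC.
apply: leq_trans (subset_leq_card sub) _.
apply: leq_trans (leq_card_setU _ _) _; apply: leq_add.
- rewrite -sum1_count (big_nth 0) big_mkord sum1_card.
  pose C := [set j : 'I_(size q) | nth 0 q j == x].
  have -> : #|[pred j : 'I_(size q) | nth 0 q j == x]| = #|C|.
    by apply: eq_card => j; rewrite !inE.
  (* [lift ord0] sends position [j] to node [j.+1], whose parent is stored there. *)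
  apply: leq_trans (leq_imset_card (lift ord0) (mem C)); apply: subset_leq_card.
  apply/subsetP => y; rewrite inE => /and3P[y0 yq qy].
  have lt_y : y.-1 < size q by lia.
  apply/imsetP; exists (Ordinal lt_y); first by rewrite inE.
  by apply: val_inj; rewrite /= /bump leq0n add1n prednK.
- have [x0|x0] := posnP x.
    rewrite leqn0 cards_eq0; apply/eqP/setP => y.
    by rewrite !inE x0.
  apply/card_le1P => y; rewrite inE => /and3P[_ _ /eqP qy] z.
  by rewrite !inE /child /= x0 -ltnS ltn_ord qy eq_sym.
Qed.

(** * Rooted tree-partitions: the invariant and its three constructions *)

Section RootedPartition.

Variables (V : finType) (e : rel V) (k d : nat).

Definition bag (U : {set V}) (f : V -> nat) (i : nat) : {set V} := [set v in U | f v == i].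

(** The strict bound [6 * d] leaves room for the edge to the parent. The root bounds are linear in
    [|S|] so that they add up under gluing; for [|S| <= 12kd] they imply the bounds on the other
    nodes. *)
Definition rooted_partition (U S : {set V}) (q : seq nat) (f : V -> nat) : Prop :=
  [/\ parent_seq q,
      (forall v, v \in U -> f v <= size q),
      (forall u v, u \in U -> v \in U -> e u v -> f u = f v \/ tree_adj q (f u) (f v)),
      (forall i, 0 < i -> count_mem i q < 6 * d /\ #|bag U f i| <= 18 * k * d)
    & [/\ (forall v, v \in S -> f v = 0),
          2 * k * count_mem 0 q + 2 * k <= #|S|
        & 2 * #|bag U f 0| + 4 * k <= 3 * #|S|]].

Lemma tree_adj_sym q : symmetric (tree_adj q).
Proof. by move=> a b; exact: orbC. Qed.

(** Membership read as a number puts [S] in bag 0 and the rest in bag 1. With one child, both root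
    bounds amount to [4k <= |S|]. *)
Lemma rooted_partition_small (U S : {set V}) :
  0 < d -> S \subset U -> 4 * k <= #|S| -> #|U :\: S| <= 4 * k ->
  rooted_partition U S [:: 0] (fun v => v \notin S).
Proof.
move=> d0 SU lbS small; split.
- by case=> [|[]].
- by move=> v _ /=; case: (v \in S).
- by move=> u v _ _ _; case: (u \in S); case: (v \in S); auto.
- move=> i i0; split; first by rewrite /=; lia.
  apply: (@leq_trans #|U :\: S|); last by nia.
  apply: subset_leq_card; apply/subsetP => v; rewrite !inE => /andP[-> /eqP fi].
  by move: i0; rewrite -fi; case: (v \in S).
- split=> [v ->//||]; first by rewrite /=; lia.
  have : #|bag U (fun v => v \notin S) 0| <= #|S|.
    by apply: subset_leq_card; apply/subsetP => v; rewrite !inE; case: (v \in S); rewrite ?andbF.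
  by lia.
Qed.

(** In [0 :: map succn q] every old node moves up by one, and the old root becomes node 1 below a
    new root. *)
Lemma child_cons0 q a b : child q a b -> child (0 :: map succn q) a.+1 b.+1.
Proof.
case: a => // a /and3P[_ aq /eqP<-]; rewrite /= size_map; apply/andP; split=> //.
by rewrite (nth_map 0).
Qed.

Lemma rooted_partition_new_root (U S S' : {set V}) q f :
  symmetric e -> 0 < k -> S \subset U -> 4 * k <= #|S| ->
  (forall u v, u \in S -> v \in U :\: S -> e u v -> v \in S') ->
  #|S'| <= 12 * k * d ->
  rooted_partition (U :\: S) S' q f ->
  rooted_partition U S (0 :: map succn q) (fun v => if v \in S then 0 else (f v).+1).
Proof.
move=> esym k0 SU lbS NS ubS' [wf fq fe counts [f0 rootdeg rootbag]].
set g := fun v => _.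
have cnt i : count_mem i.+1 (0 :: map succn q) = count_mem i q.
  by rewrite /= count_map; apply: eq_count => j /=; rewrite eqSS.
have cnt0 : count_mem 0 (0 :: map succn q) = 1.
  by rewrite /= count_map (eq_count (a2 := pred0)) // count_pred0.
have sub i : bag U g i.+1 \subset bag (U :\: S) f i.
  apply/subsetP => v; rewrite !inE /g; case: (v \in S); first by rewrite andbF.
  by rewrite eqSS.
have edge u v : u \in S -> v \in U -> e u v ->
    g u = g v \/ tree_adj (0 :: map succn q) (g u) (g v).
  move=> uS vU euv; rewrite /g uS; case: ifPn => [|vS]; first by left.
  by right; rewrite (f0 v) //; apply: NS uS _ euv; rewrite inE vS.
split.
- case=> [//|j]; rewrite /=; case: (ltnP j (size q)) => jq.
    by rewrite (nth_map 0) // ltnS.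
  by rewrite nth_default ?size_map.
- move=> v vU; rewrite /g; case: ifPn => // vS.
  by rewrite /= size_map ltnS fq // inE vS.
- move=> u v uU vU euv; have [uS|uS] := boolP (u \in S); first exact: edge.
  have [vS|vS] := boolP (v \in S).
    by rewrite tree_adj_sym; case: (edge v u vS uU _) => [|->|]; auto; rewrite esym.
  rewrite /g (negbTE uS) (negbTE vS).
  have [||->|/orP adj] := fe u v _ _ euv; rewrite ?inE ?uS ?vS //; first by left.
  by right; apply/orP; case: adj => /child_cons0; [left|right].
- case=> // i _; rewrite cnt; have := subset_leq_card (sub i).
  case: i => [|i] le_sub; last first.
    by have [cq] := counts i.+1 isT; split=> //; apply: leq_trans le_sub _.
  (* Node 1 is the old root; its root bounds and [|S'| <= 12kd] give fewer than [6d] children and at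
     most [18kd] vertices. *)
  by split; nia.
- split=> [v vS||]; first by rewrite /g vS.
    by rewrite cnt0; lia.
  have : #|bag U g 0| <= #|S|.
    by apply: subset_leq_card; apply/subsetP => v; rewrite !inE /g; case: (v \in S); rewrite ?andbF.
  by lia.
Qed.

(** [shift] identifies the two roots and moves the other nodes of the second tree past those of the
    first. *)
Lemma rooted_partition_glue (U1 U2 S S1 S2 : {set V}) q1 f1 q2 f2 :
  S \subset S1 :|: S2 ->
  U1 :&: U2 = S1 :&: S2 ->
  #|S1| + #|S2| <= #|S| + 2 * k ->
  3 * (#|S1| + #|S2|) <= 3 * #|S| + 2 * #|S1 :&: S2| + 4 * k ->
  (forall u v, u \in U1 :|: U2 -> v \in U1 :|: U2 -> e u v ->
     (u \in U1) && (v \in U1) || (u \in U2) && (v \in U2)) ->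
  S1 \subset U1 -> S2 \subset U2 ->
  rooted_partition U1 S1 q1 f1 -> rooted_partition U2 S2 q2 f2 ->
  let shift (j : nat) := if j == 0 then 0 else j + size q1 in
  rooted_partition (U1 :|: U2) S (q1 ++ map shift q2)
    (fun v => if v \in U1 then f1 v else shift (f2 v)).
Proof.
move=> SS12 capU cardS card0 sep SU1 SU2.
case=> wf1 fq1 fe1 counts1 [f10 deg1 bag1].
case=> wf2 fq2 fe2 counts2 [f20 deg2 bag2] shift.
set g := fun v => _; set q := _ ++ _.
have g1 v : v \in U1 -> g v = f1 v by rewrite /g => ->.
(* The two labellings agree on the overlap: it equals [S1 :&: S2], which both send to the root. *)
have g2 v : v \in U2 -> g v = shift (f2 v).
  move=> v2; rewrite /g; case: ifPn => // v1.
  have : v \in S1 :&: S2 by rewrite -capU inE v1.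
  by rewrite inE => /andP[s1 s2]; rewrite f10 ?f20.
have sizeq : size q = size q1 + size q2 by rewrite size_cat size_map.
have nth1 j : j < size q1 -> nth 0 q j = nth 0 q1 j by rewrite nth_cat => ->.
have nth2 j : nth 0 q (size q1 + j) = shift (nth 0 q2 j).
  rewrite nth_cat ltnNge leq_addr /= addKn; case: (ltnP j (size q2)) => jq.
    by rewrite (nth_map 0).
  by rewrite !nth_default ?size_map.
have child1 a b : child q1 a b -> child q a b.
  case/and3P=> a0 aq /eqP<-; rewrite /= a0 nth1 ?eqxx ?andbT ?sizeq; lia.
have child2 a b : child q2 a b -> child q (shift a) (shift b).
  case: a => // a /and3P[_ aq /eqP<-].
  have -> : shift a.+1 = (size q1 + a).+1 by rewrite /shift /=; lia.
  by rewrite /= nth2 eqxx andbT sizeq ltn_add2l.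
(* Parents in [q1] are below [size q1], so shifted nodes of the second tree gain no children from
   it. *)
have cnt1 (i : nat) : count_mem i q1 = 0 \/ i < size q1.
  have [iq|] := ltnP i (size q1); [by right|left].
  apply/count_memPn/negP => /(nthP 0)[j jq nj].
  by have := wf1 j; rewrite nj leqNgt (leq_trans jq).
have shift_eq (j i : nat) :
    (shift j == i) = if i == 0 then j == 0 else (size q1 < i) && (j == i - size q1).
  by rewrite /shift; case: (j =P 0); case: (i =P 0); lia.
have cnt (i : nat) : count_mem i (map shift q2) =
    if i == 0 then count_mem 0 q2 else if i <= size q1 then 0 else count_mem (i - size q1) q2.
  rewrite count_map; case: eqP => [->|/eqP i0].
    by apply: eq_count => j /=; rewrite shift_eq.
  case: leqP => iq.
    rewrite (eq_count (a2 := pred0)) ?count_pred0 // => j /=.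
    by rewrite shift_eq (negbTE i0) ltnNge iq.
  by apply: eq_count => j /=; rewrite shift_eq (negbTE i0) iq.
have subbag i : 0 < i -> bag (U1 :|: U2) g i \subset
    if i <= size q1 then bag U1 f1 i else bag U2 f2 (i - size q1).
  move=> i0; apply/subsetP => v; rewrite !inE => /andP[/orP[vU|vU]].
    by rewrite g1 // => /eqP <-; rewrite fq1 // inE vU eqxx.
  rewrite g2 // shift_eq gtn_eqF // => /andP[iq f2v].
  by rewrite leqNgt iq inE vU.
split.
- move=> j; case: (ltnP j (size q1)) => jq; first by rewrite nth1.
  rewrite -(subnKC jq) nth2 /shift; case: eqP => // _.
  by rewrite addnC leq_add2l.
- move=> v; rewrite inE sizeq => /orP[vU|vU].
    by rewrite g1 //; have := fq1 v vU; lia.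
  by rewrite g2 // /shift; case: eqP => // _; rewrite addnC leq_add2l fq2.
- move=> u v uU vU euv; case/orP: (sep u v uU vU euv) => /andP[u' v'].
    rewrite !g1 //; case: (fe1 u v u' v' euv) => [->|/orP adj]; first by left.
    by right; apply/orP; case: adj => /child1; [left|right].
  rewrite !g2 //; case: (fe2 u v u' v' euv) => [->|/orP adj]; first by left.
  by right; apply/orP; case: adj => /child2; [left|right].
- move=> i i0; rewrite count_cat cnt.
  have := subset_leq_card (subbag i i0); case: (leqP i (size q1)) => iq le_sub.
    have [c1 b1] := counts1 i i0; split; last exact: leq_trans b1.
    by case: eqP; lia.
  have [c2 b2] : count_mem (i - size q1) q2 < 6 * d /\ #|bag U2 f2 (i - size q1)| <= 18 * k * d.
    by apply: counts2; lia.
  split; last exact: leq_trans b2.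
  by case: (cnt1 i) => [->|]; case: eqP; lia.
- split.
  + move=> v /(subsetP SS12); rewrite inE => /orP[vS|vS].
      by rewrite g1 ?f10 // (subsetP SU1).
    by rewrite g2 ?f20 // (subsetP SU2).
  (* The two degree bounds bring slack [4k]; half of it pays for the excess of [|S1| + |S2|] over
     [|S|]. *)
  + rewrite count_cat cnt eqxx mulnDr.
    move: (2 * k * count_mem 0 q1) (2 * k * count_mem 0 q2) deg1 deg2 => m1 m2; lia.
  + have sub0 : bag (U1 :|: U2) g 0 \subset bag U1 f1 0 :|: bag U2 f2 0.
      apply/subsetP => v; rewrite !inE => /andP[/orP[vU|vU]].
        by rewrite g1 // vU => ->.
      by rewrite g2 // shift_eq vU eqxx => ->; rewrite orbT.
    (* The overlap lies in both root bags, so their union counts it only once. *)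
    have subI : S1 :&: S2 \subset bag U1 f1 0 :&: bag U2 f2 0.
      apply/subsetP => v; rewrite !inE => /andP[v1 v2].
      by rewrite (subsetP SU1) // (subsetP SU2) // f10 // f20.
    have := subset_leq_card sub0; have := subset_leq_card subI.
    have := cardsUI (bag U1 f1 0) (bag U2 f2 0); lia.
Qed.

Lemma rooted_partition_exists (n : nat) (t : rel 'I_n) (B : 'I_n -> {set V}) :
  symmetric e -> tree_decomposition e t B -> (forall x, #|B x| <= k) ->
  (forall v, #|[set u | e v u]| <= d) -> 0 < k -> 0 < d ->
  forall U S : {set V}, S \subset U -> 4 * k <= #|S| <= 12 * k * d ->
  exists q f, rooted_partition U S q f.
Proof.
move=> esym td Bk deg k0 d0 U; have [m] := ubnP #|U|.
elim: m U => // m IH U Um S SU /andP[lbS ubS].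
have [small|large] := leqP #|U :\: S| (4 * k).
  by exists [:: 0], (fun v => v \notin S); apply: rooted_partition_small.
have [S12|S12] := leqP #|S| (12 * k).
  pose N := (\bigcup_(s in S) [set u | e s u]) :&: (U :\: S).
  have cardN : #|N| <= 12 * k * d.
    apply: leq_trans (subset_leq_card (subsetIl _ _)) _.
    apply: leq_trans (card_bigcup_le _) _; first by move=> s _; apply: deg.
    by nia.
  (* The neighbourhood may have fewer than [4k] vertices; it is then padded, as [U :\: S] has more
     than [4k]. *)
  have [S' [NS' S'U /andP[lb' ub']]] : exists S' : {set V},
      [/\ N \subset S', S' \subset U :\: S & 4 * k <= #|S'| <= 12 * k * d].
    have [le_N|lt_N] := leqP (4 * k) #|N|.
      by exists N; split; rewrite ?le_N // subsetIr.
    have [||S' [? ? cS']] := @subset_of_card_between _ N (U :\: S) (4 * k).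
    - exact: subsetIr.
    - by lia.
    - by exists S'; split=> //; rewrite cS'; nia.
  have [|||q [f part]] := IH (U :\: S) _ S'; rewrite ?lb' //.
    by have := cardsD U S; have := subset_leq_card SU; rewrite (setIidPr SU); lia.
  exists (0 :: map succn q), (fun v => if v \in S then 0 else (f v).+1).
  apply: (rooted_partition_new_root (S' := S')) => //.
  move=> u v uS vUS euv; apply: (subsetP NS'); rewrite in_setI vUS andbT.
  by apply/bigcupP; exists u; rewrite ?inE.
have [A1 [A2 [cov cap sep S1 S2]]] := balanced_separation td S Bk.
pose X := U :&: A1 :&: A2.
have Xk : #|X| <= k.
  apply: leq_trans cap; apply: subset_leq_card; apply/subsetP => v.
  by rewrite !inE => /andP[/andP[_ ->]].
have inA v : (v \in A1) || (v \in A2) by rewrite -in_setU cov inE.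
have UE : (U :&: A1) :|: (U :&: A2) = U by rewrite -setIUr cov setIT.
(* Each side receives its private share of [S] and the whole separator inside [U], as gluing
   requires. *)
pose T1 := (S :\: A2) :|: X; pose T2 := (S :\: A1) :|: X.
have cardT (A : {set V}) : X \subset A -> #|(S :\: A) :|: X| = #|S :\: A| + #|X|.
  move=> XA; have := cardsUI (S :\: A) X.
  suff -> : (S :\: A) :&: X = set0 by rewrite cards0; lia.
  apply/setP => v; rewrite !inE; apply/negP => /andP[/andP[vA _] vX].
  by move: vA; rewrite (subsetP XA) // !inE.
have cT1 : #|T1| = #|S :\: A2| + #|X| by apply: cardT; apply: subsetIr.
have cT2 : #|T2| = #|S :\: A1| + #|X|.
  by apply: cardT; apply/subsetP => v; rewrite !inE => /andP[/andP[]].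
have cS1 := cardsID A1 S; have cS2 := cardsID A2 S.
(* Source of the threshold [12k]: [S :&: A1] has at least [|S| / 3 > 4k] vertices, so [T1] is large
   enough for the induction. *)
have subT1 : S :&: A1 \subset T1.
  apply/subsetP => v; rewrite !inE => /andP[vS ->]; rewrite vS (subsetP SU) //=.
  by case: (v \in A2).
have subT2 : S :&: A2 \subset T2.
  apply/subsetP => v; rewrite !inE => /andP[vS ->]; rewrite vS (subsetP SU) //=.
  by case: (v \in A1).
have := subset_leq_card subT1; have := subset_leq_card subT2 => lbT2 lbT1.
have T1U : T1 \subset U :&: A1.
  apply/subsetP => v; rewrite !inE; have := inA v => /orP inAv.
  move=> /orP[/andP[vA2 vS]|/andP[/andP[-> ->]] //].
  by rewrite (subsetP SU) //; case: inAv => //; rewrite (negbTE vA2).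
have T2U : T2 \subset U :&: A2.
  apply/subsetP => v; rewrite !inE; have := inA v => /orP inAv.
  move=> /orP[/andP[vA2 vS]|/andP[/andP[-> _] ->] //].
  by rewrite (subsetP SU) //; case: inAv => //; rewrite (negbTE vA2).
have T12 : T1 :&: T2 = X.
  apply/setP => v; rewrite !inE; have := inA v.
  by case: (v \in U); case: (v \in A1); case: (v \in A2); case: (v \in S).
have sumS : #|S :\: A1| + #|S :\: A2| <= #|S|.
  have := cardsUI (S :\: A1) (S :\: A2).
  have : #|S :\: A1 :|: S :\: A2| <= #|S|.
    by apply: subset_leq_card; rewrite subUset !subsetDl.
  suff -> : (S :\: A1) :&: (S :\: A2) = set0 by rewrite cards0; lia.
  by rewrite -setDUr cov setDT.
have ltU (A : {set V}) : 0 < #|S :\: A| -> #|U :&: A| < m.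
  move=> /card_gt0P[v]; rewrite inE => /andP[vA vS]; rewrite -ltnS.
  apply: leq_trans Um; rewrite ltnS; apply: proper_card.
  apply/properP; split; first exact: subsetIl.
  by exists v; rewrite ?inE ?(negbTE vA) ?andbF // (subsetP SU).
have [||q1 [f1 part1]] := IH (U :&: A1) _ T1 T1U.
(* [S :&: A2] has more than [4k] vertices, at most [k] of them in the separator, so [A1] misses a
   vertex of [S]. *)
- by apply: ltU; lia.
- by apply/andP; split; nia.
have [||q2 [f2 part2]] := IH (U :&: A2) _ T2 T2U.
- by apply: ltU; lia.
- by apply/andP; split; nia.
eexists; eexists; rewrite -{1}UE; apply: rooted_partition_glue part1 part2 => //.
- apply/subsetP => v vS; rewrite !inE vS (subsetP SU) //.
  by case: (v \in A1); case: (v \in A2).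
- by rewrite T12 setIACA setIid setIA.
- by lia.
(* The separator contributes [6|X|] on the left, at most [2|X| + 4k]. *)
- by rewrite T12; lia.
- by rewrite UE => u v uU vU euv; rewrite !inE uU vU; apply: sep.
Qed.

End RootedPartition.

(** * From the rooted partition to the tree-partition *)

Theorem theorem2 (V : finType) (e : rel V) :
  simple_graph e -> nontrivial e ->
  exists (n : nat) (t : rel 'I_n) (P : 'I_n -> {set V}),
    [/\ is_tree t, maxdeg t <= 6 * maxdeg e, T_partition e t P &
        partition_width P <= 18 * (treewidth e).+1 * maxdeg e].
Proof.
move=> [esym _] [u0 [v0 euv0]]; set k := (treewidth e).+1; set d := maxdeg e.
have deg v : #|[set u | e v u]| <= d by rewrite /d /maxdeg (leq_bigmax v).
have d0 : 0 < d.
  by apply: leq_trans (deg u0); apply/card_gt0P; exists v0; rewrite inE.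
have [n [t [B [td Bk]]]] : has_td_width e (treewidth e).
  rewrite /treewidth; case: ex_minnP => m; rewrite /has_td_widthb.
  by case: ClassicalEpsilon.excluded_middle_informative.
have [q [f [wf fq fe cnt bags]]] : exists q f,
    [/\ parent_seq q, (forall v, f v <= size q),
        (forall u v, e u v -> f u = f v \/ tree_adj q (f u) (f v)),
        (forall i, count_mem i q + (0 < i) <= 6 * d)
      & (forall i, #|[set v : V | f v == i]| <= 18 * k * d)].
  (* With at most [4k] vertices a single bag suffices; otherwise any [4k] vertices serve as [S],
     which leaves the root at most one child and [4k] vertices. *)
  have [small|large] := leqP #|V| (4 * k).
    exists [::], (fun=> 0); split=> //.
    - by case=> [|[]].
    - by auto.
    - by move=> i; rewrite /=; lia.
    - by move=> i; apply: leq_trans (max_card _) _; nia.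
  have [||S [_ _ cS]] := @subset_of_card_between V set0 setT (4 * k).
  - exact: sub0set.
  - by rewrite cards0 cardsT; lia.
  have cardS : 4 * k <= #|S| <= 12 * k * d by rewrite cS; nia.
  have [q [f [wf fq fe cb [_ deg0 bag0]]]] :=
    rooted_partition_exists esym td Bk deg (ltn0Sn _) d0 (subsetT S) cardS.
  have bagE i : [set v | f v == i] = bag setT f i by apply/setP => v; rewrite !inE.
  exists q, f; split=> //.
  - by move=> v; apply: fq; rewrite inE.
  - by move=> u v; apply: fe; rewrite inE.
  - by case=> [|i]; [nia|have [] := cb i.+1 isT; lia].
  - by case=> [|i]; rewrite bagE; [nia|have [] := cb i.+1 isT].
exists (size q).+1, (parent_tree q), (fun x : 'I_(size q).+1 => [set v | f v == x]); split.
- exact: parent_tree_is_tree.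
- by apply/bigmax_leqP => x _; apply: leq_trans (parent_tree_degree x wf) (cnt x).
- split.
  + move=> x y xy; rewrite -setI_eq0; apply/eqP/setP => v; rewrite !inE.
    by apply/negP => /andP[/eqP-> /eqP/val_inj exy]; rewrite exy eqxx in xy.
  + apply/setP => v; rewrite [RHS]inE; apply/bigcupP.
    by exists (Ordinal (fq v : f v < (size q).+1)); rewrite ?inE.
  + move=> v w x y evw; rewrite !inE => /eqP fv /eqP fw.
    case: (fe v w evw) => [fvw|adj]; last by right; rewrite /parent_tree /= -fv -fw.
    by left; apply: val_inj; rewrite /= -fv -fw.
- by apply/bigmax_leqP => x _; apply: bags.
Qed.
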